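(* Consider the probabilistic filtering ODE solver arising from the twice integrated Wiener process IWP$(2)$ with fixed step size $h>0$ and intensity $\sigma^2>0$, written in rescaled coordinates. When the predictive distribution has reached the steady state, its predictive posterior mean is a third order Nordsieck method. That is, if $C_{t_0}$ is in the steady state, then: (i) there is a constant vector $l\in\mathbb{R}^3$, not depending on $n$, $h$, $\sigma^2$ or $f$, such that the means satisfy, for all $n\ge1$, $$m_{t_n}=(I-l\,e_1^{\top})P\,m_{t_{n-1}}+h\,l\,z_n,\qquad z_n=f\big(t_n,(P\,m_{t_{n-1}})_0\big);$$ (ii) this Nordsieck method has order three.
   Context: Vectors and matrices are indexed from $0$; $e_0,e_1,e_2$ is the standard basis of $\mathbb{R}^3$, and $I$ is the $3\times3$ identity. Problem: $y'(t)=f(t,y(t))$, $y(t_0)=y_0$ on $[t_0,T]$, with $f:[t_0,T]\times\mathbb{R}\to\mathbb{R}$ Lipschitz continuous in its second argument and sufficiently many times differentiable; mesh $t_n=t_0+nh$. IWP$(2)$: the process $X_t=(Y_t,Y'_t,Y''_t)^{\top}$ with $dX_t=U_3X_t\,dt+e_2\,dW_t$, where $U_3$ is the upper shift matrix and $W$ is a Wiener process of intensity $\sigma^2$. In the rescaled (Nordsieck) coordinates $\tilde X_t=(Y_t,\,hY'_t,\,\tfrac{h^2}{2}Y''_t)^{\top}$ the transition matrix over one step is the Pascal matrix $$P=\begin{pmatrix}1&1&1\\0&1&2\\0&0&1\end{pmatrix},$$ the diffusion matrix $\tilde Q(h)\in\mathbb{R}^{3\times3}$ has entries $$(\tilde Q(h))_{ij}=\frac{\sigma^2h^{5}}{(5-i-j)\,(2-i)!\,(2-j)!\,i!\,j!},\qquad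 0\le i,j\le2,$$ and the derivative is observed through $\tilde H_1=h^{-1}e_1^{\top}$. Filter: given a mean $m_{t_{n-1}}\in\mathbb{R}^3$ and covariance $C_{t_{n-1}}$, one step ($n\ge1$) of the probabilistic filtering ODE solver (Kalman filter with noise-free observations) is $$C^-_{t_n}=PC_{t_{n-1}}P^{\top}+\tilde Q(h),\quad z_n=f(t_n,(Pm_{t_{n-1}})_0),\quad K_n=C^-_{t_n}\tilde H_1^{\top}[\tilde H_1C^-_{t_n}\tilde H_1^{\top}]^{-1},$$ $$m_{t_n}=(I-K_n\tilde H_1)Pm_{t_{n-1}}+K_nz_n,\qquad C_{t_n}=(I-K_n\tilde H_1)C^-_{t_n}.$$ The vectors $m_{t_n}$ are the predictive posterior means. Steady state: a covariance matrix $C$ is in the steady state if it has the form $$C=\sigma^2h^5\begin{pmatrix}c_{00}&0&c_{02}\\0&0&0\\c_{02}&0&c_{22}\end{pmatrix}$$ (a valid, i.e. positive semidefinite, covariance matrix; $c_{00}$ is otherwise arbitrary) in which the coefficients $(c_{02},c_{22})$ are the fixed point, under the covariance map $C_{t_{n-1}}\mapsto C_{t_n}$ of the filter, of the induced map on these two coefficients, namely $c_{22}=\frac{\sqrt3}{24}$, $c_{02}=-\frac{\sqrt3}{144}$. The index $0$ denotes a mesh point at which the steady state has been reached. Nordsieck method: a recursion $x_{n}=(I-l e_1^{\top})Px_{n-1}+h\,l\,z_n$ with a constant weight vector $l$, where $x_n$ approximates the Nordsieck vector $\big(y(t_n),\,hy'(t_n),\,\tfrac{h^2}{2}y''(t_n)\big)^{\top}$;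 here $z_n$ is a single evaluation of $f$ at the predicted value $(Px_{n-1})_0$ (P(EC)$^1$ mode). Order three means: there is $k\in\mathbb{N}$ such that for every $f:[t_0,T]\times\mathbb{R}\to\mathbb{R}$ of class $C^k$ that is Lipschitz in its second argument, every $y_0$ with corresponding solution $y$ on $[t_0,T]$, and every constant $c\ge0$, there exist $h_0>0$ and $D\ge0$ such that for all $h=(T-t_0)/N\le h_0$ ($N\in\mathbb{N}$) and every starting vector $x_0$ with $\big\|x_0-\big(y(t_0),hy'(t_0),\tfrac{h^2}{2}y''(t_0)\big)^{\top}\big\|\le c\,h^3$, the method satisfies $|(x_n)_0-y(t_n)|\le D\,h^3$ for all $0\le n\le N$. *)

(* Defs.v *)
From HB Require Import structures.
From mathcomp Require Import all_boot all_order all_algebra.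
From mathcomp Require Import all_classical all_reals all_analysis.

Set Implicit Arguments.
Unset Strict Implicit.
Unset Printing Implicit Defensive.

Import Order.TTheory GRing.Theory Num.Theory numFieldNormedType.Exports.

Local Open Scope classical_set_scope.
Local Open Scope ring_scope.

Section Nordsieck.
Context {R : realType}.

Definition e1 : 'cV[R]_3 := delta_mx 1 0.

Definition pascal : 'M[R]_3 := \matrix_(i, j) 'C(j, i)%:R.

Definition mesh (t0 h : R) (n : nat) : R := t0 + n%:R * h.

(** The intensity of the Wiener process is [sigma ^+ 2]. *)
Definition diffusion (sigma h : R) : 'M[R]_3 :=
  \matrix_(i, j) (sigma ^+ 2 * h ^+ 5 /
    ((5 - i - j) * (2 - i)`! * (2 - j)`! * i`! * j`!)%N%:R).

Definition obs (h : R) : 'rV[R]_3 := h^-1 *: e1^T.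

Definition cov_pred (sigma h : R) (C : 'M[R]_3) : 'M[R]_3 :=
  pascal *m C *m pascal^T + diffusion sigma h.

Definition gain (sigma h : R) (C : 'M[R]_3) : 'cV[R]_3 :=
  let Cpred := cov_pred sigma h C in
  Cpred *m (obs h)^T *m invmx (obs h *m Cpred *m (obs h)^T).

Definition cov_step (sigma h : R) (C : 'M[R]_3) : 'M[R]_3 :=
  (1%:M - gain sigma h C *m obs h) *m cov_pred sigma h C.

(** The observation [z_n], with [t = t_n] and [x] the previous state. *)
Definition eval_pred (f : R -> R -> R) (t : R) (x : 'cV[R]_3) : R :=
  f t ((pascal *m x) 0 0).

Definition mean_step (f : R -> R -> R) (sigma h t : R)
    (m : 'cV[R]_3) (C : 'M[R]_3) : 'cV[R]_3 :=
  (1%:M - gain sigma h C *m obs h) *m (pascal *m m)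
  + gain sigma h C *m (eval_pred f t m)%:M.

(** Mean and covariance at the [n]-th mesh point, from mean [m0] and
    covariance [C0] at [t0]. *)
Fixpoint ode_filter (f : R -> R -> R) (sigma t0 h : R)
    (m0 : 'cV[R]_3) (C0 : 'M[R]_3) (n : nat) : 'cV[R]_3 * 'M[R]_3 :=
  if n is n'.+1 then
    let: (m, C) := ode_filter f sigma t0 h m0 C0 n' in
    (mean_step f sigma h (mesh t0 h n) m C, cov_step sigma h C)
  else (m0, C0).

Definition psd (C : 'M[R]_3) : Prop :=
  C^T = C /\ forall v : 'cV[R]_3, 0 <= (v^T *m C *m v) 0 0.

Definition steady_form (sigma h c00 c02 c22 : R) : 'M[R]_3 :=
  (sigma ^+ 2 * h ^+ 5) *: \matrix_(i, j)
    (nth [::] [:: [:: c00; 0; c02];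
                  [:: 0;   0; 0  ];
                  [:: c02; 0; c22]] i)`_j.

(** The fixed point equations in [c22], [c02] do not involve [c00]; those two
    values are their only solution with [0 <= c22]. *)
Definition steady_state (sigma h : R) (C : 'M[R]_3) : Prop :=
  exists c00 c02 c22 : R,
    [/\ C = steady_form sigma h c00 c02 c22,
        psd C,
        cov_step sigma h C 0 2 = C 0 2 /\ cov_step sigma h C 2 2 = C 2 2
      & c22 = Num.sqrt 3 / 24 /\ c02 = - (Num.sqrt 3 / 144)].

Definition nordsieck_step (l : 'cV[R]_3) (h z : R) (x : 'cV[R]_3) : 'cV[R]_3 :=
  (1%:M - l *m e1^T) *m (pascal *m x) + (h * z) *: l.

Fixpoint nordsieck (l : 'cV[R]_3) (f : R -> R -> R) (t0 h : R)
    (x0 : 'cV[R]_3) (n : nat) : 'cV[R]_3 :=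
  if n is n'.+1 then
    let x := nordsieck l f t0 h x0 n' in
    nordsieck_step l h (eval_pred f (mesh t0 h n) x) x
  else x0.

(** Derivatives on the closed interval [[a, b]] are one-sided at [a] and [b].
    [deriv_on] is meaningful only where the limit exists. *)
Definition has_deriv_on (a b : R) (g : R -> R) (t dg : R) : Prop :=
  (g s - g t) / (s - t) @[s --> within `[a, b] t^'] --> dg.

Definition deriv_on (a b : R) (g : R -> R) (t : R) : R :=
  lim ((g s - g t) / (s - t) @[s --> within `[a, b] t^']).

(** [f] is of class C^k on the strip [[a, b] x R], values of [f] outside the
    strip being irrelevant; [ft] and [fy] are the two partial derivatives. *)
Fixpoint Ck_strip (a b : R) (k : nat) (f : R -> R -> R) : Prop :=
  {within `[a, b] `*` setT, continuous (fun p : R * R => f p.1 p.2)} /\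
  if k is k'.+1 then
    exists ft fy : R -> R -> R,
      [/\ forall t y : R, t \in `[a, b] -> has_deriv_on a b (f^~ y) t (ft t y),
          forall t y : R, t \in `[a, b] -> is_derive y 1 (f t) (fy t y),
          Ck_strip a b k' ft
        & Ck_strip a b k' fy]
  else True.

Definition lipschitz_snd (a b : R) (f : R -> R -> R) : Prop :=
  exists L : R, forall t, t \in `[a, b] -> L.-lipschitz (f t).

Definition ivp_solution (f : R -> R -> R) (t0 T y0 : R) (y : R -> R) : Prop :=
  y t0 = y0 /\ forall t, t \in `[t0, T] -> has_deriv_on t0 T y t (f t (y t)).

Definition nordsieck_vector (t0 T h : R) (y : R -> R) (t : R) : 'cV[R]_3 :=
  \col_i [:: y t; h * deriv_on t0 T y t;
             h ^+ 2 / 2 * deriv_on t0 T (deriv_on t0 T y) t]`_i.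

(** On vectors, [`|_|] is the maximum norm. *)
Definition order_three (l : 'cV[R]_3) (t0 T : R) : Prop :=
  exists k : nat, forall f : R -> R -> R,
    Ck_strip t0 T k f -> lipschitz_snd t0 T f ->
  forall (y0 : R) (y : R -> R), ivp_solution f t0 T y0 y ->
  forall c : R, 0 <= c ->
  exists h0 D : R, [/\ 0 < h0, 0 <= D &
    forall N : nat, (0 < N)%N -> let h := (T - t0) / N%:R in h <= h0 ->
    forall x0 : 'cV[R]_3, `|x0 - nordsieck_vector t0 T h y t0| <= c * h ^+ 3 ->
    forall n : nat, (n <= N)%N ->
      `|nordsieck l f t0 h x0 n 0 0 - y (mesh t0 h n)| <= D * h ^+ 3].

End Nordsieck.

(* Main.v *)
Require Import Defs.
From mathcomp Require Import all_boot all_order all_algebra.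
From mathcomp Require Import all_classical all_reals all_analysis.
From mathcomp Require Import ring lra.
Import Order.TTheory GRing.Theory Num.Theory numFieldNormedType.Exports.

Set Implicit Arguments.
Unset Strict Implicit.
Unset Printing Implicit Defensive.

Local Open Scope classical_set_scope.
Local Open Scope ring_scope.

(** Part (i). A steady covariance is determined by its entry [c00], and neither
    column [1] of the predicted covariance nor the other entries of the updated
    one involve it. Hence the update stays in the steady family, and the gain is
    always [h] times one vector [l], column [1] of the predicted covariance
    divided by its middle entry:
    [l = ((3 + sqrt 3) / 12, 1, (3 - sqrt 3) / 2)].

    Part (ii). The local error of the method is of order [h ^+ 3] in its first
    and last coordinates, so that adding up local errors would only give order
    two. The linear form [w x = x_0 + x_1 / 2 + x_2 / 6] repairs this. It has
    [w l = 1] and [w (P x) - (P x)_1 = w x], so that a step of the method is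
    [w x_n = w x_(n-1) + h z_n]. Applied to the exact solution, the same
    recursion is the trapezoidal rule with end correction, whose defect
    [y(t+h) - y(t) - h/2 (y'(t) + y'(t+h)) + h^2/12 (y''(t+h) - y''(t))]
    is of order [h ^+ 4] (lemma [truncation_bounds]) and so accumulates to order
    [h ^+ 3]. In the two other coordinates nothing accumulates: coordinate [1]
    is overwritten at each step by [h z_n], and coordinate [2] is contracted by
    the factor [1 - 2 l_2 = sqrt 3 - 2]. If [w] of the error and these two
    coordinates of it are bounded by fixed multiples of some [G], then one step
    preserves these bounds with [G] enlarged by a factor [1 + O(h)] (lemma
    [error_step]), which gives convergence of order three.

    The Taylor remainders need four derivatives of [y]. They are obtained by
    iterating the total derivative [G |-> G_t + G_y f] along the solution
    (lemma [Ck_along_solution]), which maps class [C^(k+1)] to class [C^k];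
    class [C^3] of [f] suffices. *)

(** * Gain and covariance in the steady state *)

Definition nordsieck_weights {R : realType} : 'cV[R]_3 :=
  \col_i [:: (3 + Num.sqrt 3) / 12; 1; (3 - Num.sqrt 3) / 2]`_i.

Definition mx3 {R : realType} (s : seq (seq R)) : 'M[R]_3 :=
  \matrix_(i, j) (nth [::] s i)`_j.

Definition steady_cov {R : realType} (c : R) : 'M[R]_3 :=
   mx3 [:: [:: c; 0; - (Num.sqrt 3 / 144)]; [:: 0; 0; 0];
           [:: - (Num.sqrt 3 / 144); 0; Num.sqrt 3 / 24]].

Section SteadyState.
Context {R : realType}.
Let s3 : R := Num.sqrt 3.
Let s3K : s3 ^+ 2 = 3. Proof. by rewrite sqr_sqrtr. Qed.
Let s3_gt0 : 0 < s3. Proof. by rewrite sqrtr_gt0. Qed.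

Lemma sum3 (F : 'I_3 -> R) : \sum_i F i = F 0 + F 1 + F 2.
Proof.
rewrite !big_ord_recr big_ord0 /= add0r.
by congr (F _ + F _ + F _); apply: val_inj.
Qed.

Lemma ord3P (P : 'I_3 -> Prop) : P 0 -> P 1 -> P 2 -> forall i, P i.
Proof.
move=> P0 P1 P2 [[|[|[|//]]] lti].
- by rewrite (_ : Ordinal lti = 0) //; apply: val_inj.
- by rewrite (_ : Ordinal lti = 1) //; apply: val_inj.
- by rewrite (_ : Ordinal lti = 2) //; apply: val_inj.
Qed.

Lemma pascalE :
  pascal = mx3 [:: [:: 1; 1; 1]; [:: 0; 1; 2]; [:: 0; 0; 1]] :> 'M[R]_3.
Proof. by apply/matrixP; elim/ord3P; elim/ord3P; rewrite !mxE. Qed.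

Lemma diffusionE (sigma h : R) : diffusion sigma h = (sigma ^+ 2 * h ^+ 5) *:
  mx3 [:: [:: 20^-1; 8^-1; 12^-1]; [:: 8^-1; 3^-1; 4^-1];
          [:: 12^-1; 4^-1; 4^-1]].
Proof. by apply/matrixP; elim/ord3P; elim/ord3P; rewrite !mxE. Qed.

(** As [c] occurs in the corner entry only, the gain does not depend on it. *)
Lemma cov_pred_steady_cov (sigma h c : R) :
  cov_pred sigma h ((sigma ^+ 2 * h ^+ 5) *: steady_cov c) =
  (sigma ^+ 2 * h ^+ 5) *:
   mx3 [:: [:: c + s3 / 36 + 20^-1; (9 + 5 * s3) / 72 ; (12 + 5 * s3)/ 144];
           [:: (9 + 5 * s3) / 72; (2 + s3) / 6 ; (3 + s3)/12];
           [:: (12 + 5 * s3)/ 144; (3 + s3)/12 ; (6 + s3) / 24]].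
Proof.
rewrite /cov_pred pascalE diffusionE -scalemxAr -scalemxAl -scalerDr.
congr (_ *: _); apply/matrixP; elim/ord3P; elim/ord3P;
 rewrite !mxE !sum3 !mxE !sum3 !mxE /= -/s3; by field.
Qed.

Lemma scale_obs (h : R) (l : 'cV[R]_3) : h != 0 ->
  (h *: l) *m obs h = l *m e1^T.
Proof.
by move=> h0; rewrite -scalemxAl -scalemxAr scalerA divff // scale1r.
Qed.

(** The observation is scalar, so that the matrix inverse is a division. *)
Lemma gainE (sigma h : R) (C : 'M[R]_3) : h != 0 ->
  cov_pred sigma h C 1 1 != 0 ->
  gain sigma h C = (h / cov_pred sigma h C 1 1) *: col 1 (cov_pred sigma h C).
Proof.
move=> h0; rewrite /gain /obs; move: (cov_pred _ _ _) => Q Q0.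
rewrite linearZ /= trmxK -!scalemxAr -!scalemxAl.
have -> : e1^T *m Q *m e1 = (Q 1 1)%:M.
  rewrite /e1 trmx_delta -rowE -colE; apply/matrixP => i j.
  by rewrite !ord1 !mxE eqxx mulr1n.
rewrite !scale_scalar_mx invmx_scalar /e1 -colE mul_mx_scalar !scalerA.
congr (_ *: _); field.
by rewrite Q0 h0.
Qed.

Lemma gain_steady_cov (sigma h c : R) : h != 0 -> sigma != 0 ->
  gain sigma h ((sigma ^+ 2 * h ^+ 5) *: steady_cov c) = h *: nordsieck_weights.
Proof.
move=> h0 sg0; have s3_gt0' := s3_gt0.
have s2 : 2 + s3 != 0 by rewrite lt0r_neq0 ?addr_gt0.
rewrite gainE // cov_pred_steady_cov; last first.
  by rewrite !mxE /= !mulf_neq0 ?expf_neq0 ?invr_neq0 ?pnatr_eq0.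
apply/matrixP => i j; rewrite ord1 {j}; elim/ord3P: i; rewrite !mxE /= -/s3.
all: field: s3K.
all: by rewrite s2 h0 sg0.
Qed.

(** A noise-free observation annihilates the row and the column of the observed
    coordinate, and the two coefficients in [sqrt 3] are reproduced because they
    solve the fixed point equations. The corner entry does change, but it never
    feeds back into the others. *)
Lemma cov_step_steady_cov (sigma h c : R) : h != 0 -> sigma != 0 ->
  exists c', cov_step sigma h ((sigma ^+ 2 * h ^+ 5) *: steady_cov c) =
    (sigma ^+ 2 * h ^+ 5) *: steady_cov c'.
Proof.
move=> h0 sg0.
(* the predicted corner entry, minus [l_0] times the predicted entry (0, 1) *)
exists (c + s3 / 36 + 20^-1 - (3 + s3) / 12 * ((9 + 5 * s3) / 72)).
rewrite /cov_step gain_steady_cov // scale_obs // cov_pred_steady_cov.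
rewrite /e1 trmx_delta -scalemxAr.
congr (_ *: _); rewrite mulmxBl mul1mx -mulmxA -rowE.
apply/matrixP; elim/ord3P; elim/ord3P; rewrite !mxE big_ord1 !mxE /= -/s3;
  by field: s3K.
Qed.

Lemma mean_step_weights f (sigma h t : R) m C : h != 0 ->
  gain sigma h C = h *: nordsieck_weights ->
  mean_step f sigma h t m C =
  nordsieck_step nordsieck_weights h (eval_pred f t m) m.
Proof.
move=> h0 K; by rewrite /mean_step K scale_obs // mul_mx_scalar scalerA mulrC.
Qed.

Lemma ode_filter_steady_cov f (sigma t0 h : R) m0 C0 n :
  h != 0 -> sigma != 0 -> steady_state sigma h C0 ->
  exists c, (ode_filter f sigma t0 h m0 C0 n).2 =
            (sigma ^+ 2 * h ^+ 5) *: steady_cov c.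
Proof.
move=> h0 sg0 [c [c02 [c22 [-> _ _ [-> ->]]]]].
elim: n => [|n]; first by exists c.
rewrite /=; case: ode_filter => m C /= [c' ->]; exact: cov_step_steady_cov.
Qed.

Lemma ode_filter_nordsieck f (sigma t0 h : R) m0 C0 n :
  h != 0 -> sigma != 0 -> steady_state sigma h C0 ->
  let m := (ode_filter f sigma t0 h m0 C0 n).1 in
  (ode_filter f sigma t0 h m0 C0 n.+1).1 =
  nordsieck_step nordsieck_weights h (eval_pred f (mesh t0 h n.+1) m) m.
Proof.
move=> h0 sg0 /(ode_filter_steady_cov f t0 m0 n h0 sg0) [c] /=.
case: ode_filter => m C /= ->.
by rewrite mean_step_weights // gain_steady_cov.
Qed.

End SteadyState.

(** * One-sided derivatives and Taylor remainders on a closed interval *)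

Section DerivativesOnInterval.
Context {R : realType}.
Implicit Types (a b t s d e u v B : R) (g y : R -> R).

(** Without the division by [s - t] the estimate also holds at [s = t], so that
    the punctured neighbourhood disappears. *)
Lemma has_deriv_onP a b g t (d : R) : has_deriv_on a b g t d <->
  forall e : R, 0 < e -> exists2 r : R, 0 < r & forall s, s \in `[a, b] ->
    `|s - t| < r -> `|g s - g t - d * (s - t)| <= e * `|s - t|.
Proof.
rewrite /has_deriv_on; split.
  move/cvgrPdist_le => cg e e0; have := cg e e0.
  rewrite near_withinE => /nbhs_ballP[r /= r0 rP].
  exists r => // s sab str; have [->|nst] := eqVneq s t.
    by rewrite !subrr mulr0 subr0 normr0 mulr0.
  have st0 : s - t != 0 by rewrite subr_eq0.
  have /= := rP s _ nst sab; rewrite /ball /= distrC => /(_ str) H.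
  rewrite (_ : _ - _ = - (d - (g s - g t) / (s - t)) * (s - t)); last by field.
  by rewrite normrM normrN ler_wpM2r.
move=> H; apply/cvgrPdist_le => e e0; have [r r0 rP] := H e e0.
rewrite near_withinE; apply/nbhs_ballP; exists r => //= s + nst sab.
rewrite /ball /= distrC => str.
have st0 : s - t != 0 by rewrite subr_eq0.
rewrite -(ler_pM2r (x := `|s - t|)) ?normr_gt0 //.
by rewrite (le_trans _ (rP s sab str)) // -normrM distrC mulrBl divfK.
Qed.

(** Makes limits along this filter unique. It would fail on a degenerate
    interval, hence [a < b]; the witnesses move towards the midpoint, so as to
    stay in the interval when [t] is an end point. *)
Lemma has_deriv_on_proper a b t : a < b -> t \in `[a, b] ->
  ProperFilter (within `[a, b] t^').
Proof.
move=> ab /[!in_itv]/= /andP[at_ tb].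
apply: Build_ProperFilter_ex => P /nbhs_ballP[r /= r0 rP].
pose d := Num.min (r / 2) ((b - a) / 2).
have d0 : 0 < d by rewrite lt_min !divr_gt0 // subr_gt0.
have dr : d < r by rewrite gt_min; apply/orP; left; lra.
have dba : d <= (b - a) / 2 by rewrite ge_min lexx orbT.
have [tm|tm] := leP t ((a + b) / 2).
- exists (t + d); apply: rP.
  + by rewrite /ball /= opprD addrA subrr sub0r normrN gtr0_norm.
  + by rewrite -subr_eq0 addrC addKr gt_eqF.
  + by rewrite /= in_itv /=; lra.
- exists (t - d); apply: rP.
  + by rewrite /ball /= opprB addrC subrK gtr0_norm.
  + by rewrite -subr_eq0 addrC addKr oppr_eq0 gt_eqF.
  + by rewrite /= in_itv /=; lra.
Qed.

Lemma deriv_onE a b g t d : a < b -> t \in `[a, b] ->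
  has_deriv_on a b g t d -> deriv_on a b g t = d.
Proof.
by move=> ab tab H; have := has_deriv_on_proper ab tab => ?; apply: cvg_lim.
Qed.

Lemma eq_has_deriv_on a b g1 g2 t d : t \in `[a, b] ->
  (forall s, s \in `[a, b] -> g1 s = g2 s) ->
  has_deriv_on a b g1 t d -> has_deriv_on a b g2 t d.
Proof.
move=> tab E /has_deriv_onP H; apply/has_deriv_onP => e /H[r r0 rP].
by exists r => // s sab; rewrite -!E //; apply: rP.
Qed.

Lemma has_deriv_on_is_derive a b g t d : t \in `]a, b[ ->
  has_deriv_on a b g t d -> is_derive t 1 g d.
Proof.
move=> tab /has_deriv_onP H.
have : h^-1 *: (g (h *: 1 + t) - g t) @[h --> 0^'] --> d.
  apply/cvgrPdist_le => e e0; have [r r0 rP] := H e e0.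
  have : \forall s \near t, s \in `[a, b].
    by apply: filterS (near_in_itvoo tab) => s; apply: subset_itv_oo_cc.
  move=> /nbhs_ballP[r' /= r'0 r'P].
  apply/nbhs_ballP; exists (Num.min r r'); first by rewrite /= lt_min r0.
  move=> h /=; rewrite /ball /= sub0r normrN lt_min => /andP[hr hr'] h0.
  have hn : 0 < `|h| by rewrite normr_gt0.
  have E : h *: 1 + t - t = h by rewrite addrK /GRing.scale /= mulr1.
  have sab : h *: 1 + t \in `[a, b].
    by apply: r'P; rewrite /ball /= distrC E.
  have := rP _ sab; rewrite E => /(_ hr) Hh.
  rewrite -(ler_pM2r hn) (le_trans _ Hh) // -normrM distrC mulrBl.
  by rewrite {1}/GRing.scale /= mulrAC mulVf // mul1r.
move=> C; split; last exact: cvg_lim.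
by apply/cvg_ex; exists d.
Qed.

Lemma has_deriv_on_continuous a b g dg :
  (forall t, t \in `[a, b] -> has_deriv_on a b g t (dg t)) ->
  {within `[a, b], continuous g}.
Proof.
move=> H; apply/subspace_continuousP => t /= tab.
have [r r0 rP] := (has_deriv_onP _ _ _ _ _).1 (H _ tab) 1 ltr01.
apply/cvgrPdist_le => e e0.
rewrite near_withinE; apply/nbhs_ballP.
have K0 : 0 < 1 + `|dg t| by rewrite ltr_pwDl.
exists (Num.min r (e / (1 + `|dg t|))); first by rewrite /= lt_min r0 divr_gt0.
move=> s; rewrite /ball /= distrC lt_min => /andP[sr se] sab.
rewrite distrC (le_trans (y := (1 + `|dg t|) * `|s - t|)) //; last first.
  by rewrite mulrC -ler_pdivlMr // ltW.
rewrite -[g s - g t](subrK (dg t * (s - t))) mulrDl -normrM.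
by rewrite (le_trans (ler_normD _ _)) // lerD2r rP.
Qed.

Lemma is_derive_littleo g t d : is_derive t 1 g d ->
  forall e : R, 0 < e -> exists2 r : R, 0 < r & forall s,
    `|s - t| < r -> `|g s - g t - d * (s - t)| <= e * `|s - t|.
Proof.
case=> /= C dE e e0.
have {dE}C : h^-1 *: (g (h *: 1 + t) - g t) @[h --> 0^'] --> d.
  by rewrite -dE; apply: C.
move/cvgrPdist_le/(_ e e0): C.
rewrite near_withinE => /nbhs_ballP[r /= r0 rP]; exists r => // s str.
have [->|nst] := eqVneq s t.
  by rewrite !subrr mulr0 subr0 normr0 mulr0.
have st0 : s - t != 0 by rewrite subr_eq0.
have /= := rP (s - t) _ st0; rewrite /ball /= sub0r normrN => /(_ str).
rewrite [(s - t) *: 1]mulr1 subrK => H.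
rewrite -[g s - g t](mulVKf st0) [d * _]mulrC -mulrBr normrM mulrC distrC.
by rewrite ler_wpM2r.
Qed.

(** The mean value theorem for [g - q]. Only [q], a Taylor polynomial or a
    linear function below, is differentiable beyond the interval. *)
Lemma mvt_bound a b g dg q dq u v B :
  (forall t, t \in `[a, b] -> has_deriv_on a b g t (dg t)) ->
  (forall t, is_derive t 1 q (dq t)) ->
  a <= u -> u <= v -> v <= b ->
  (forall t, t \in `[u, v] -> `|dg t - dq t| <= B) ->
  `|(g v - q v) - (g u - q u)| <= B * (v - u).
Proof.
move=> Dg Dq au uv vb HB.
have sub : `[u, v] `<=` `[a, b] by apply: subset_itvScc; rewrite bnd_simp.
have [||c cuv ->] := @MVT_segment R (g \- q) (fun t => dg t - dq t) u v uv.
- move=> x xuv; apply: is_deriveB => //.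
  apply: (@has_deriv_on_is_derive a b).
    by move: xuv; rewrite !in_itv /= => /andP[]; lra.
  by apply: Dg; apply: sub; apply: subset_itv_oo_cc xuv.
- apply: (continuous_subspaceW sub); apply: within_continuousB.
    exact: has_deriv_on_continuous Dg.
  apply: continuous_subspaceT => x; apply: differentiable_continuous.
  by apply/derivable1_diffP; apply: ex_derive.
- by rewrite normrM (ger0_norm (_ : 0 <= v - u)) ?subr_ge0 // ler_wpM2r
    ?subr_ge0 ?HB.
Qed.

Definition taylor_poly k (g : nat -> R -> R) t (s : R) : R :=
  \sum_(i < k) g i t * (s - t) ^+ i / i`!%:R.

Lemma is_derive_taylor_poly k (g : nat -> R -> R) t (s : R) :
  is_derive s 1 (taylor_poly k.+1 g t)
    (taylor_poly k (fun i => g i.+1) t s).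
Proof.
pose T i : R -> R := fun s => g i t * (s - t) ^+ i / i`!%:R.
have -> : taylor_poly k.+1 g t = \sum_(i < k.+1) T i.
  by apply/funext => x; rewrite fct_sumE.
(* the constant term has derivative 0; the others shift down by one *)
pose dT i := if i is j.+1 then g j.+1 t * (s - t) ^+ j / j`!%:R else 0.
have -> : taylor_poly k (fun i => g i.+1) t s = \sum_(i < k.+1) dT i.
  by rewrite big_ord_recl /= add0r; apply: eq_bigr.
apply: is_derive_sum => i; case: (i : nat) => [|j].
  rewrite (_ : T 0%N = cst (g 0%N t)); first exact: is_derive_cst.
  by apply/funext => x; rewrite /T expr0 fact0 mulr1 divr1.
have D : is_derive s 1 (fun x : R => x - t) 1.
  by apply: is_derive_eq; rewrite subr0.
have -> : T j.+1 = (g j.+1 t / j.+1`!%:R) *: (fun x : R => x - t) ^+ j.+1.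
  by apply/funext => x; rewrite /T fctE mulrAC.
apply: is_derive_eq; rewrite /= /GRing.scale /=.
have fact_neq0 : j`!%:R != 0 :> R by rewrite pnatr_eq0 -lt0n fact_gt0.
have succ_neq0 : j.+1%:R != 0 :> R by rewrite pnatr_eq0.
rewrite factS natrM; move: _%:R _%:R fact_neq0 succ_neq0 => p q p0 q0.
by field; rewrite p0 q0.
Qed.

(** The derivative of a Taylor remainder is the remainder of one order less for
    the derivative, and the remainder vanishes at [t]; bounding the derivative
    by its largest value at each stage is why the factor [1 / k!] is missing. *)
Lemma taylor a b k (g : nat -> R -> R) (M t s : R) :
  (forall i, (i < k)%N -> forall x, x \in `[a, b] ->
    has_deriv_on a b (g i) x (g i.+1 x)) ->
  (forall x, x \in `[a, b] -> `|g k x| <= M) ->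
  a <= t -> t <= s -> s <= b ->
  `|g 0%N s - taylor_poly k g t s| <= M * (s - t) ^+ k.
Proof.
elim: k g s => [|k IH] g s Dg gM at_ ts sb.
  rewrite /taylor_poly big_ord0 subr0 expr0 mulr1 gM //.
  by rewrite in_itv /= (le_trans at_).
(* only the term [i = 0] survives at [t] *)
have tt : g 0%N t - taylor_poly k.+1 g t t = 0.
  rewrite /taylor_poly big_ord_recl /= expr0 fact0 mulr1 divr1.
  rewrite big1 ?addr0 ?subrr //.
  by move=> i _; rewrite ?subrr expr0n /= mulr0 mul0r.
rewrite -[X in `|X|]subr0 -tt exprSr mulrA.
apply: (mvt_bound (Dg 0%N (ltn0Sn _)) (is_derive_taylor_poly k g t)) => // x.
rewrite in_itv /= => /andP[tx xs].
have M0 : 0 <= M.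
  by apply: le_trans (gM t _); rewrite // in_itv /= at_ (le_trans ts).
apply: (le_trans (IH (fun i => g i.+1) x _ _ _ _ _)) => //.
- by move=> i ik; apply: Dg.
- exact: le_trans sb.
- by rewrite ler_wpM2l // lerXn2r ?nnegrE ?lerD2r ?subr_ge0 // (le_trans tx).
Qed.

Lemma has_deriv_onD a b g1 g2 t d1 d2 :
   has_deriv_on a b g1 t d1 -> has_deriv_on a b g2 t d2 ->
   has_deriv_on a b (fun s => g1 s + g2 s) t (d1 + d2).
Proof.
rewrite /has_deriv_on => H1 H2.
have -> : (fun s : R => (g1 s + g2 s - (g1 t + g2 t)) / (s - t)) =
  (fun s : R => (g1 s - g1 t) / (s - t)) \+ (fun s => (g2 s - g2 t) / (s - t)).
  by apply/funext => s /=; rewrite -mulrDl opprD addrACA.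
exact: cvgD.
Qed.

Lemma has_deriv_on_cvg a b g t d : has_deriv_on a b g t d ->
  g s @[s --> within `[a, b] t^'] --> g t.
Proof.
rewrite /has_deriv_on => H.
have st : (fun s : R => s - t) @ within `[a, b] t^' --> (0 : R).
  rewrite -(subrr t); apply: cvgB; last exact: cvg_cst.
  apply: cvg_trans (cvg_within _) _; exact: cvg_within.
have E : ((fun s : R => (g s - g t) / (s - t)) \* (fun s : R => s - t)) \+
          cst (g t) = g.
  apply/funext => s /=; have [->|nst] := eqVneq s t.
    by rewrite !subrr mulr0 add0r.
  by rewrite divfK ?subrK // subr_eq0.
have : g @ within `[a, b] t^' --> d * 0 + g t.
  rewrite -[X in X @ _]E; apply: cvgD; first exact: cvgM.
  exact: cvg_cst.
by rewrite mulr0 add0r.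
Qed.

Lemma has_deriv_onM a b g1 g2 t d1 d2 :
   has_deriv_on a b g1 t d1 -> has_deriv_on a b g2 t d2 ->
   has_deriv_on a b (fun s => g1 s * g2 s) t (d1 * g2 t + g1 t * d2).
Proof.
move=> H1 H2; have c2 := has_deriv_on_cvg H2; rewrite /has_deriv_on.
have -> : (fun s : R => (g1 s * g2 s - g1 t * g2 t) / (s - t)) =
  ((fun s : R => (g1 s - g1 t) / (s - t)) \* g2) \+
  ((fun s : R => g1 t) \* (fun s => (g2 s - g2 t) / (s - t))).
  by apply/funext => s /=; ring.
apply: cvgD; apply: cvgM => //; exact: cvg_cst.
Qed.

End DerivativesOnInterval.

(** * Derivatives along a solution *)

Section AlongSolution.
Context {R : realType}.
Implicit Types (a b t s d dy gy x : R) (y : R -> R).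

Definition strip_continuous a b (G : R -> R -> R) :=
  {within `[a, b] `*` setT, continuous (fun p : R * R => G p.1 p.2)}.

Lemma strip_continuousP a b (G : R -> R -> R) t x : strip_continuous a b G ->
  t \in `[a, b] -> forall e : R, 0 < e -> exists2 r : R, 0 < r & forall s z,
    s \in `[a, b] -> `|s - t| < r -> `|z - x| < r -> `|G s z - G t x| <= e.
Proof.
move=> /subspace_continuousP cG tab e e0.
have /cG /cvgrPdist_le/(_ e e0) : (`[a, b] `*` setT)%classic (t, x) by [].
rewrite near_withinE => /nbhs_ballP[r /= r0 rP]; exists r => // s z sab st zx.
by rewrite distrC; apply: (rP (s, z)) => //; split; rewrite /ball /= distrC.
Qed.

(** The chain rule for [G] along a curve, assuming partial derivatives only, one
    of them jointly continuous. The increment is split at [G t (y s)]. The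
    change in time is controlled by the mean value theorem at the fixed second
    argument [y s], the change in space by differentiability of [G t] at the
    single point [y t]. *)
Lemma has_deriv_on_strip a b (G Gt : R -> R -> R) gy y dy t :
  strip_continuous a b Gt ->
  (forall s x, s \in `[a, b] -> has_deriv_on a b (G^~ x) s (Gt s x)) ->
  is_derive (y t) 1 (G t) gy ->
  t \in `[a, b] -> has_deriv_on a b y t dy ->
  has_deriv_on a b (fun s => G s (y s)) t (Gt t (y t) + gy * dy).
Proof.
move=> cGt DGt DGy tab /has_deriv_onP Dy; apply/has_deriv_onP => e e0.
have [e' e3 ->] : exists2 e' : R, 0 < e' & e = 3 * e' by exists (e / 3); lra.
have [r1 r10 GtP] := strip_continuousP (y t) cGt tab e3.
pose K : R := `|dy| + 1; have K0 : 0 < K by rewrite ltr_wpDl.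
pose K' : R := `|gy| + 1; have K'0 : 0 < K' by rewrite ltr_wpDl.
have [r2 r20 GyP] := is_derive_littleo DGy (divr_gt0 e3 K0).
have [r3 r30 yP1] := Dy _ ltr01.
have [r4 r40 yP] := Dy _ (divr_gt0 e3 K'0).
pose r0 : R := Num.min r1 r2.
have r00 : 0 < r0 by rewrite lt_min r10.
exists (Num.min r1 (Num.min (Num.min r3 r4) (r0 / K))).
  by rewrite !lt_min r10 r30 r40 divr_gt0.
move=> s sab; rewrite !lt_min => /and3P[st1 /andP[st3 st4]].
rewrite ltr_pdivlMr // => st0.
(* [y] is Lipschitz at [t], so that smallness in space follows from time *)
have ys : `|y s - y t| <= K * `|s - t|.
  rewrite -[y s - y t](subrK (dy * (s - t))) addrC mulrDl -normrM.
  by rewrite (le_trans (ler_normD _ _)) // lerD2l yP1.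
have ysr : `|y s - y t| < r0 by rewrite (le_lt_trans ys) // mulrC.
move: ysr; rewrite lt_min => /andP[ysr1 ysr2].
have H1 : `|G s (y s) - G t (y s) - Gt t (y t) * (s - t)| <= e' * `|s - t|.
  have Dl : forall c : R, is_derive c 1 ( *%R (Gt t (y t))) (Gt t (y t)).
    move=> c; apply: (is_derive_eq (is_deriveZ _ _)); exact: mulr1.
  have bnd (u v : R) : u <= v -> u \in `[a, b] -> v \in `[a, b] ->
      (forall c, c \in `[u, v] -> `|c - t| < r1) ->
      `|G v (y s) - G u (y s) - Gt t (y t) * (v - u)| <= e' * (v - u).
    move=> uv /[!in_itv]/= /andP[au _] /andP[_ vb] cl.
    have -> : G v (y s) - G u (y s) - Gt t (y t) * (v - u) =
      G v (y s) - Gt t (y t) * v - (G u (y s) - Gt t (y t) * u) by ring.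
    apply: (mvt_bound (fun c => DGt c (y s)) Dl) => // c cuv.
    apply: GtP => //; last exact: cl.
    by move: cuv; rewrite !in_itv /= => /andP[]; lra.
  have [ts|ts] := leP t s.
    rewrite (ger0_norm (_ : 0 <= s - t)) ?subr_ge0 //; apply: bnd => // c.
    rewrite in_itv /= => /andP[tc cs].
    rewrite ger0_norm ?subr_ge0 // (le_lt_trans _ st1) //.
    by rewrite ger0_norm ?subr_ge0 // lerD2r.
  rewrite distrC [`|s - t|]distrC.
  rewrite (ger0_norm (_ : 0 <= t - s)) ?subr_ge0 ?(ltW ts) //.
  rewrite (_ : _ - _ = G t (y s) - G s (y s) - Gt t (y t) * (t - s));
    last by ring.
  apply: bnd => //; first exact: ltW.
  move=> c; rewrite in_itv /= => /andP[sc ct].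
  rewrite distrC ger0_norm ?subr_ge0 // (le_lt_trans _ st1) // distrC.
  by rewrite ger0_norm ?subr_ge0 ?(ltW ts) // lerB.
have H2 : `|G t (y s) - G t (y t) - gy * (y s - y t)| <= e' * `|s - t|.
  apply: (le_trans (GyP _ ysr2)).
  by rewrite mulrAC ler_pdivrMr // -mulrA ler_wpM2l ?(ltW e3) // mulrC.
have H3 : `|gy * (y s - y t - dy * (s - t))| <= e' * `|s - t|.
  rewrite normrM (le_trans (y := K' * (e' / K' * `|s - t|))) //.
    rewrite ler_pM ?normr_ge0 //; first by rewrite lerDl.
    exact: yP.
  by rewrite mulrA mulrCA divff ?gt_eqF // mulr1.
rewrite (_ : _ - _ = (G s (y s) - G t (y s) - Gt t (y t) * (s - t)) +
  (G t (y s) - G t (y t) - gy * (y s - y t)) +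
  gy * (y s - y t - dy * (s - t))); last by ring.
rewrite (le_trans (ler_normD _ _)) //.
rewrite (le_trans (lerD (ler_normD _ _) (lexx _))) //.
move: H1 H2 H3; lra.
Qed.

Lemma Ck_strip_continuous a b k G : Ck_strip a b k G -> strip_continuous a b G.
Proof. by case: k => [|k] []. Qed.

Lemma Ck_stripW a b k G : Ck_strip a b k.+1 G -> Ck_strip a b k G.
Proof.
elim: k G => [|k IH] G [cG]; first by [].
move=> [Gt [Gy [? ? Ct Cy]]]; split => //; exists Gt, Gy.
by split => //; apply: IH.
Qed.

Lemma Ck_stripD a b k G1 G2 : Ck_strip a b k G1 -> Ck_strip a b k G2 ->
  Ck_strip a b k (fun t x => G1 t x + G2 t x).
Proof.
elim: k G1 G2 => [|k IH] G1 G2 [c1 D1] [c2 D2].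
  by split => //; apply: within_continuousD.
split; first by apply: within_continuousD.
move: D1 D2 => [Gt1 [Gy1 [Dt1 Dy1 Ct1 Cy1]]] [Gt2 [Gy2 [Dt2 Dy2 Ct2 Cy2]]].
exists (fun t x => Gt1 t x + Gt2 t x), (fun t x => Gy1 t x + Gy2 t x).
split; [| |exact: IH|exact: IH] => t x tab.
- by apply: has_deriv_onD; [exact: Dt1|exact: Dt2].
- by apply: is_deriveD; [exact: Dy1|exact: Dy2].
Qed.

Lemma strip_continuousM a b G1 G2 : strip_continuous a b G1 ->
  strip_continuous a b G2 -> strip_continuous a b (fun t x => G1 t x * G2 t x).
Proof. by move=> c1 c2 x; apply: cvgM; [exact: c1|exact: c2]. Qed.

(** The product rule pairs a partial derivative with an undifferentiated factor,
    which is why each factor is also used in the class below. *)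
Lemma Ck_stripM a b k G1 G2 : Ck_strip a b k G1 -> Ck_strip a b k G2 ->
  Ck_strip a b k (fun t x => G1 t x * G2 t x).
Proof.
elim: k G1 G2 => [|k IH] G1 G2 C1 C2.
  by case: C1 C2 => [c1 _] [c2 _]; split => //; apply: strip_continuousM.
have [W1 W2] := (Ck_stripW C1, Ck_stripW C2); move: C1 C2 => [c1 D1] [c2 D2].
split; first by apply: strip_continuousM.
move: D1 D2 => [Gt1 [Gy1 [Dt1 Dy1 Ct1 Cy1]]] [Gt2 [Gy2 [Dt2 Dy2 Ct2 Cy2]]].
exists (fun t x => Gt1 t x * G2 t x + G1 t x * Gt2 t x),
       (fun t x => Gy1 t x * G2 t x + G1 t x * Gy2 t x).
split; [| |apply: Ck_stripD; exact: IH|apply: Ck_stripD; exact: IH] => t x tab.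
- by apply: (has_deriv_onM (Dt1 _ _ tab) (Dt2 _ _ tab)).
- apply: (is_derive_eq (is_deriveM (Dy1 _ _ tab) (Dy2 _ _ tab))).
  by rewrite /GRing.scale /=; ring.
Qed.

Lemma strip_bounded a b G y (dy : R -> R) : a <= b -> strip_continuous a b G ->
  (forall t, t \in `[a, b] -> has_deriv_on a b y t (dy t)) ->
  exists M, forall t, t \in `[a, b] -> `|G t (y t)| <= M.
Proof.
move=> ab cG Dy.
have cGy : {within `[a, b], continuous (fun t => `|G t (y t)|)}.
  apply/subspace_continuousP => t /= tab; apply: cvg_norm.
  apply/cvgrPdist_le => e e0.
  have [r r0 rP] := strip_continuousP (y t) cG tab e0.
  have /subspace_continuousP/(_ t tab) := has_deriv_on_continuous Dy.
  move/cvgrPdist_lt/(_ r r0) => yr; near=> s.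
  rewrite distrC; apply: rP.
  - by near: s; apply: withinT.
  - near: s; apply: cvg_within; apply/nbhs_ballP; exists r => // s.
    by rewrite /ball /= distrC.
  - by rewrite distrC; near: s.
have [c _ cM] := EVT_max ab cGy.
by exists `|G c (y c)|.
Unshelve. all: by end_near.
Qed.

(** If [G] is of class C^(k+1), then the derivative of [t |-> G t (y t)] is
    [t |-> DG t (y t)] with [DG = G_t + G_y f] of class C^k. Iterating
    [G |-> DG] gives all derivatives of [G] along [y], each of them continuous
    on a compact interval and so bounded. *)
Lemma Ck_along_solution a b k f G y : a <= b ->
  Ck_strip a b k f -> Ck_strip a b k G ->
  (forall t, t \in `[a, b] -> has_deriv_on a b y t (f t (y t))) ->
  exists g : nat -> R -> R, [/\ g 0%N = fun t => G t (y t),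
    forall i, (i < k)%N -> forall t, t \in `[a, b] ->
      has_deriv_on a b (g i) t (g i.+1 t) &
    exists M, forall i, (i <= k)%N -> forall t, t \in `[a, b] -> `|g i t| <= M].
Proof.
move=> ab Cf CG Dy; elim: k G Cf CG => [|k IH] G Cf CG.
  exists (fun _ t => G t (y t)); split => //.
  have [M GM] := strip_bounded ab (Ck_strip_continuous CG) Dy.
  by exists M => i _; apply: GM.
have [M0 GM] := strip_bounded ab (Ck_strip_continuous CG) Dy.
have CG1 := Ck_stripW CG; case: CG => _ [Gt [Gy [Dt DGy Ct Cy]]].
have Cf1 := Ck_stripW Cf.
have CD : Ck_strip a b k (fun t x => Gt t x + Gy t x * f t x).
  by apply: Ck_stripD => //; apply: Ck_stripM.
have [g [g0 Dg [M gM]]] := IH _ Cf1 CD.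
exists (fun i => if i is j.+1 then g j else fun t => G t (y t)); split => //.
  case=> [_|i ik] t tab; last exact: Dg.
  rewrite g0; apply: has_deriv_on_strip => //.
  - exact: Ck_strip_continuous Ct.
  - exact: (DGy t (y t) tab).
  - exact: Dy.
exists (Num.max M0 M) => -[_|i ik] t tab; rewrite le_max.
  by rewrite GM.
by rewrite gM ?orbT.
Qed.

End AlongSolution.

(** * Propagation of the error and convergence *)

Section Convergence.
Context {R : realType}.
Local Notation s3 := (Num.sqrt 3 : R).

Lemma sqrt3_bounds : 5 / 3 <= s3 <= 2.
Proof.
have s0 : 0 <= s3 := sqrtr_ge0 _.
have s2 : s3 ^+ 2 = 3 by rewrite sqr_sqrtr.
by apply/andP; split; rewrite leNgt; apply/negP => ?; nra.
Qed.

Lemma nordsieck_stepE (h z : R) (x : 'cV[R]_3) :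
  let r := h * z - x 1 0 - 2 * x 2 0 in
  let x' := nordsieck_step nordsieck_weights h z x in
  [/\ x' 0 0 = x 0 0 + x 1 0 + x 2 0 + (3 + s3) / 12 * r,
      x' 1 0 = h * z & x' 2 0 = x 2 0 + (3 - s3) / 2 * r].
Proof.
rewrite /= /nordsieck_step mulmxBl mul1mx -mulmxA /e1 trmx_delta -rowE pascalE.
split; rewrite !mxE big_ord1 !mxE !sum3 !mxE /=; by field.
Qed.

Lemma pascal_mul0 (x : 'cV[R]_3) : (pascal *m x) 0 0 = x 0 0 + x 1 0 + x 2 0.
Proof. by rewrite pascalE mxE sum3 !mxE /= !mul1r. Qed.

Lemma entry_le_norm (x : 'cV[R]_3) i : `|x i 0| <= `|x|.
Proof.
rewrite [leRHS]/Num.norm /= mx_normrE.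
by apply/bigmax_geP; right => /=; exists (i, 0).
Qed.

(** The first entry is the form [w], which the method preserves up to
    [h z]. The weight [4] of the last coordinate is what its contraction
    requires: with the bounds [2 / 3] for [l_2] and [1 / 3] for the contraction
    factor, its new value is at most [4 / 3 + 2 / 3] times [G], plus terms below
    [G]. *)
Definition error_le (G : R) (e : 'cV[R]_3) :=
  [/\ `|e 0 0 + e 1 0 / 2 + e 2 0 / 6| <= G, `|e 1 0| <= G & `|e 2 0| <= 4 * G].

(** The Nordsieck vector of a function with derivatives [g 0], [g 1], [g 2] at
    one point. *)
Definition nordsieck_col (h : R) (g : nat -> R) : 'cV[R]_3 :=
  \col_i [:: g 0%N; h * g 1%N; h ^+ 2 / 2 * g 2%N]`_i.

(** One step of the method from [x] against a function with derivatives [g] at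
    the old and [g'] at the new mesh point. All three coordinates of the new
    error involve the evaluation error [dl = h (z - g' 1)], which the Lipschitz
    condition bounds by [6 L h G]; besides,
    - [w] changes by [dl] and the quadrature defect [tau], of order [h ^+ 4];
    - coordinate [1] is [dl];
    - coordinate [2] is contracted, and receives [l_2] times coordinate [1],
      [l_2 dl], and local errors of order [h ^+ 3].
    The condition [14 L h <= 1] keeps [6 L h G] below [G / 2], and
    [2 M h ^+ 3 <= G] makes the local errors of order [h ^+ 3] harmless. *)
Lemma error_step (L M h G z : R) (g g' : nat -> R) (x : 'cV[R]_3) :
  0 <= L -> 0 <= M -> 0 <= h -> 14 * L * h <= 1 -> 2 * M * h ^+ 3 <= G ->
  `|z - g' 1%N| <= L * `|(pascal *m x) 0 0 - g' 0%N| ->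
  `|g' 0%N - (g 0%N + h * g 1%N + h ^+ 2 / 2 * g 2%N)| <= M * h ^+ 3 ->
  `|g' 1%N - (g 1%N + h * g 2%N)| <= M * h ^+ 2 ->
  `|g' 2%N - g 2%N| <= M * h ->
  `|g' 0%N - g 0%N - h / 2 * (g' 1%N + g 1%N) +
    h ^+ 2 / 12 * (g' 2%N - g 2%N)| <= 2 * M * h ^+ 4 ->
  error_le G (x - nordsieck_col h g) ->
  error_le (G * (1 + (6 * L + 1) * h))
    (nordsieck_step nordsieck_weights h z x - nordsieck_col h g').
Proof.
move=> L0 M0 h0 Lh MG; rewrite pascal_mul0.
have := nordsieck_stepE h z x; move: (nordsieck_step _ _ _ _) => x' /= [].
rewrite /error_le !mxE /=.
move: (x' 0 0) (x' 1 0) (x' 2 0) => a' b' c' {x'}.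
move: (x 0 0) (x 1 0) (x 2 0) => a b c {x}.
move: (g 0%N) (g 1%N) (g 2%N) => y y1 y2 {g}.
move: (g' 0%N) (g' 1%N) (g' 2%N) => Y Y1 Y2 {g'}.
move=> -> -> -> Hz Hrho H1 H2 Htau [Hu Hb Hc].
have M3 : 0 <= M * h ^+ 3 by rewrite mulr_ge0 ?exprn_ge0.
have G0 : 0 <= G by lra.
have := sqrt3_bounds; move: (s3) => s /andP[s1 s2].
set u := a - y + (b - h * y1) / 2 + (c - h ^+ 2 / 2 * y2) / 6 in Hu *.
set eb := b - h * y1 in Hb *; set ec := c - h ^+ 2 / 2 * y2 in Hc *.
set rho := Y - _ in Hrho.
set tau := Y - y - _ + _ in Htau.
set d1 := Y1 - _ in H1; set d2 := Y2 - _ in H2.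
have Hp : `|a + b + c - Y| <= 6 * G.
  have -> : a + b + c - Y = u + eb / 2 + 5 / 6 * ec - rho.
    by rewrite /u /eb /ec /rho; field.
  move: Hu Hb Hc Hrho; rewrite !ler_norml.
  move=> /andP[? ?] /andP[? ?] /andP[? ?] /andP[? ?].
  by apply/andP; split; lra.
pose dl := h * (z - Y1).
have Hd : `|dl| <= 6 * L * h * G.
  rewrite normrM (ger0_norm h0).
  rewrite (_ : 6 * L * h * G = h * (L * (6 * G))); last by ring.
  by rewrite ler_wpM2l // (le_trans Hz) // ler_wpM2l.
have Hd' : 6 * L * h * G <= G / 2.
  rewrite (_ : 6 * L * h * G = 6 / 14 * (14 * L * h * G)); last by field.
  have : 14 * L * h * G <= 1 * G by rewrite ler_wpM2r.
  lra.
have hG : 0 <= h * G by rewrite mulr_ge0.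
have LhG : 0 <= L * h * G by rewrite !mulr_ge0.
have Gup : G * (1 + (6 * L + 1) * h) = G + 6 * L * h * G + h * G by ring.
have Ht : 2 * M * h ^+ 4 <= h * G.
  by rewrite exprS mulrCA ler_wpM2l.
split; rewrite Gup.
- rewrite (_ : _ + _ = u + dl - tau); last first.
    by rewrite /u /dl /tau /eb /ec; field.
  move: Hu Hd Htau; rewrite !ler_norml => /andP[? ?] /andP[? ?] /andP[? ?].
  by apply/andP; split; lra.
- rewrite (_ : _ - _ = dl); last by rewrite /dl; ring.
  move: Hd; rewrite !ler_norml => /andP[? ?].
  by apply/andP; split; lra.
- pose q := (3 - s) / 2.
  rewrite (_ : _ - _ = (1 - 2 * q) * ec - q * eb + q * dl + q * (h * d1)
     - h ^+ 2 / 2 * d2); last by rewrite /q /dl /d1 /d2 /eb /ec; field.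
  have q0 : 0 <= q by rewrite /q; lra.
  have q1 : q <= 2 / 3 by rewrite /q; lra.
  have A1 : `|(1 - 2 * q) * ec| <= 3^-1 * (4 * G).
    by rewrite normrM ler_pM // ler_norml /q; apply/andP; split; lra.
  have A2 : `|q * eb| <= 2 / 3 * G by rewrite normrM (ger0_norm q0) ler_pM.
  have A3 : `|q * dl| <= 2 / 3 * (6 * L * h * G).
    by rewrite normrM (ger0_norm q0) ler_pM.
  have A4 : `|q * (h * d1)| <= 2 / 3 * (M * h ^+ 3).
    rewrite normrM (ger0_norm q0) ler_pM // normrM (ger0_norm h0).
    by rewrite (exprS h 2) mulrCA ler_wpM2l.
  have A5 : `|h ^+ 2 / 2 * d2| <= 2^-1 * (M * h ^+ 3).
    rewrite mulrAC mulrC normrM ger0_norm ?invr_ge0 // ler_wpM2l ?invr_ge0 //.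
    rewrite normrM ger0_norm ?exprn_ge0 //.
    rewrite (_ : M * h ^+ 3 = h ^+ 2 * (M * h)); last by ring.
    by rewrite ler_wpM2l ?exprn_ge0.
  move: A1 A2 A3 A4 A5; rewrite !ler_norml.
  move=> /andP[? ?] /andP[? ?] /andP[? ?] /andP[? ?] /andP[? ?].
  by apply/andP; split; lra.
Qed.

(** The last bound is the quadrature defect along [w]. Combining the Taylor
    expansions of [g 0], [g 1] and [g 2] with the weights [1], [- h / 2] and
    [h ^+ 2 / 12] cancels the third derivative: [1 / 6 - 1 / 4 + 1 / 12 = 0]. *)
Lemma truncation_bounds (a b t h M : R) (g : nat -> R -> R) :
  (forall i, (i < 4)%N -> forall x, x \in `[a, b] ->
    has_deriv_on a b (g i) x (g i.+1 x)) ->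
  (forall i, (3 <= i <= 4)%N -> forall x, x \in `[a, b] -> `|g i x| <= M) ->
  a <= t -> 0 <= h -> t + h <= b ->
  [/\ `|g 0%N (t + h) - (g 0%N t + h * g 1%N t + h ^+ 2 / 2 * g 2%N t)|
        <= M * h ^+ 3,
      `|g 1%N (t + h) - (g 1%N t + h * g 2%N t)| <= M * h ^+ 2,
      `|g 2%N (t + h) - g 2%N t| <= M * h &
      `|g 0%N (t + h) - g 0%N t - h / 2 * (g 1%N (t + h) + g 1%N t) +
        h ^+ 2 / 12 * (g 2%N (t + h) - g 2%N t)| <= 2 * M * h ^+ 4].
Proof.
move=> Dg gM at_ h0 thb.
have th : t <= t + h by rewrite lerDl.
have E : t + h - t = h by ring.
have tay j k : (3 <= j + k <= 4)%N ->
    `|g j (t + h) - taylor_poly k (fun i => g (i + j)%N) t (t + h)|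
      <= M * h ^+ k.
  move=> jk; rewrite -[in X in _ <= X]E.
  apply: (@taylor _ a b k (fun i => g (i + j)%N)) => //.
    case/andP: jk => _ jk i ik; apply: Dg.
    by rewrite (leq_trans _ jk) // addnC ltn_add2l.
  by apply: gM; rewrite addnC.
have := (tay 0 3 isT, tay 1 2 isT, tay 2 1 isT,
  (tay 0 4 isT, tay 1 3 isT, tay 2 2 isT)).
rewrite /taylor_poly !big_ord_recr !big_ord0 /= !E !(addn0, addSn, add0n).
rewrite !(expr0, expr1, add0r, mulr1).
move: (g 0%N t) (g 1%N t) (g 2%N t) (g 3%N t) => y y1 y2 y3.
move: (g 0%N _) (g 1%N _) (g 2%N _) => Y Y1 Y2.
rewrite /factorial /= !divr1.
move=> [[[b1 b2] b3] [[b4 b5] b6]]; split => //.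
- by move: b1; congr (`|_| <= _); field.
- by move: b2; congr (`|_| <= _); field.
set r4 := (X in `|X| <= _) in b4.
set r5 := (X in `|X| <= _) in b5.
set r6 := (X in `|X| <= _) in b6.
rewrite (_ : _ + _ = r4 - h / 2 * r5 + h ^+ 2 / 12 * r6); last first.
  by rewrite /r4 /r5 /r6; field.
have M0 : 0 <= M * h ^+ 4.
  rewrite mulr_ge0 ?exprn_ge0 // (le_trans _ (gM 3%N isT t _)) // in_itv /= at_.
  exact: le_trans thb.
have c5 : `|h / 2 * r5| <= 2^-1 * (M * h ^+ 4).
  rewrite normrM ger0_norm ?divr_ge0 //.
  rewrite (_ : 2^-1 * (M * h ^+ 4) = h / 2 * (M * h ^+ 3)); last by ring.
  by rewrite ler_wpM2l ?divr_ge0.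
have c6 : `|h ^+ 2 / 12 * r6| <= 12^-1 * (M * h ^+ 4).
  rewrite normrM ger0_norm ?divr_ge0 ?exprn_ge0 //.
  rewrite (_ : 12^-1 * (M * h ^+ 4) = h ^+ 2 / 12 * (M * h ^+ 2)); last by ring.
  by rewrite ler_wpM2l ?divr_ge0 ?exprn_ge0.
move: b4 c5 c6; rewrite !ler_norml => /andP[? ?] /andP[? ?] /andP[? ?].
by apply/andP; split; lra.
Qed.

(** [deriv_on] is defined by a limit, whose value is known on the interval only;
    this is enough for the second derivative, which is a limit within it. *)
Lemma nordsieck_vectorE (t0 T h t : R) (y : R -> R) (g : nat -> R -> R) :
  t0 < T -> t \in `[t0, T] -> g 0%N = y ->
  (forall i, (i < 2)%N -> forall x, x \in `[t0, T] ->
    has_deriv_on t0 T (g i) x (g i.+1 x)) ->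
  nordsieck_vector t0 T h y t = nordsieck_col h (g^~ t).
Proof.
move=> tT tin <- Dg.
have E s : s \in `[t0, T] -> deriv_on t0 T (g 0%N) s = g 1%N s.
  by move=> sin; apply: deriv_onE => //; apply: Dg.
have E2 : deriv_on t0 T (deriv_on t0 T (g 0%N)) t = g 2%N t.
  apply: deriv_onE => //; apply: (eq_has_deriv_on tin (g1 := g 1%N)).
    by move=> s sin; rewrite E.
  exact: Dg.
by apply/matrixP => i j; rewrite !mxE E // E2.
Qed.

Lemma error_le_norm (e : 'cV[R]_3) : error_le (2 * `|e|) e.
Proof.
have := (entry_le_norm e 0, entry_le_norm e 1, entry_le_norm e 2).
rewrite /error_le !ler_norml => -[[/andP[? ?] /andP[? ?]] /andP[? ?]].
by split; apply/andP; split; lra.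
Qed.

Lemma error_leW G G' (e : 'cV[R]_3) : G <= G' -> error_le G e -> error_le G' e.
Proof.
move=> GG [e0 e1 e2]; split; [exact: le_trans GG|exact: le_trans GG|].
by rewrite (le_trans e2) // ler_wpM2l.
Qed.

Lemma error_le_fst G (e : 'cV[R]_3) : error_le G e -> `|e 0 0| <= 3 * G.
Proof.
rewrite /error_le !ler_norml => -[/andP[? ?] /andP[? ?] /andP[? ?]].
by apply/andP; split; lra.
Qed.

Lemma nordsieck_error (f : R -> R -> R) (t0 T h L M G0 : R)
    (g : nat -> R -> R) (x0 : 'cV[R]_3) (n : nat) :
  (forall t, t \in `[t0, T] ->
    forall x x', `|f t x - f t x'| <= L * `|x - x'|) ->
  (forall t, t \in `[t0, T] -> g 1%N t = f t (g 0%N t)) ->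
  (forall i, (i < 4)%N -> forall x, x \in `[t0, T] ->
    has_deriv_on t0 T (g i) x (g i.+1 x)) ->
  (forall i, (3 <= i <= 4)%N -> forall x, x \in `[t0, T] -> `|g i x| <= M) ->
  0 <= L -> 0 <= M -> 0 <= h -> 14 * L * h <= 1 -> 2 * M * h ^+ 3 <= G0 ->
  error_le G0 (x0 - nordsieck_col h (g^~ t0)) ->
  mesh t0 h n <= T ->
  error_le (G0 * (1 + (6 * L + 1) * h) ^+ n)
    (nordsieck nordsieck_weights f t0 h x0 n
       - nordsieck_col h (g^~ (mesh t0 h n))).
Proof.
move=> Lf gf Dg gM L0 M0 h0 Lh MG e0.
elim: n => [|n IH] /=; first by rewrite /mesh mul0r addr0 expr0 mulr1.
have meshS : mesh t0 h n.+1 = mesh t0 h n + h by rewrite /mesh -natr1; ring.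
rewrite meshS => nT.
have tn : t0 <= mesh t0 h n by rewrite lerDl mulr_ge0.
have nT' : mesh t0 h n <= T by rewrite (le_trans _ nT) // lerDl.
have [r0 r1 r2 tau] := truncation_bounds Dg gM tn h0 nT.
have inT : mesh t0 h n + h \in `[t0, T].
  by rewrite in_itv /= nT (le_trans tn) // lerDl.
rewrite exprSr mulrA; apply: (error_step L0 M0 h0 Lh _ _ r0 r1 r2 tau) => //.
- rewrite (le_trans MG) // ler_peMr ?(le_trans _ MG) ?mulr_ge0 ?exprn_ge0 //.
  by rewrite exprn_ege1 // lerDl mulr_ge0 // addr_ge0 // mulr_ge0.
- by rewrite gf //; apply: Lf.
- exact: IH.
Qed.

(** The total growth over a fixed interval is bounded independently of the
    number [N] of steps. *)
Lemma growth_bound (k h : R) (n N : nat) : 0 <= k -> 0 <= h -> (n <= N)%N ->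
  (1 + k * h) ^+ n <= expR (k * (N%:R * h)).
Proof.
move=> k0 h0 nN.
have kh : 0 <= k * h by rewrite mulr_ge0.
rewrite (le_trans (y := (1 + k * h) ^+ N)) //.
  by rewrite ler_weXn2l // lerDl.
rewrite mulrCA expRM_natl lerXn2r ?nnegrE ?expR_ge0 ?addr_ge0 //.
exact: expR_ge1Dx.
Qed.

Lemma nordsieck_order_three (t0 T : R) : t0 < T ->
  order_three nordsieck_weights t0 T.
Proof.
move=> tT; exists 3%N => f Cf [L0 Lip] y0 y [_ Dy] c c0.
pose L := `|L0|; have LL : 0 <= L := normr_ge0 _.
have [g' [g'0 Dg' [M gM']]] := Ck_along_solution (ltW tT) Cf Cf Dy.
pose g i := if i is j.+1 then g' j else y.
have gf t : g 1%N t = f t (y t) by rewrite /g g'0.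
have Dg i : (i < 4)%N -> forall x, x \in `[t0, T] ->
    has_deriv_on t0 T (g i) x (g i.+1 x).
  case: i => [_|i i3] x xin; last exact: Dg'.
  by rewrite gf; apply: Dy.
have gM i : (3 <= i <= 4)%N -> forall x, x \in `[t0, T] -> `|g i x| <= M.
  by case: i => [//|i /andP[_ i3]] x xin; apply: gM'.
have t0in : t0 \in `[t0, T] by rewrite in_itv /= lexx ltW.
have M0 : 0 <= M by rewrite (le_trans _ (gM 3%N isT t0 t0in)).
have fL t : t \in `[t0, T] -> forall x x', `|f t x - f t x'| <= L * `|x - x'|.
  move=> tin x x'; have /= H := Lip t tin (x, x') (conj I I).
  by rewrite (le_trans H) // ler_wpM2r // ler_norm.
have hL0 : 0 < 14 * (L + 1) by rewrite mulr_gt0 // ltr_wpDl.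
(* large enough both for the starting error and for [2 M h ^+ 3 <= G] *)
pose K := 2 * c + 2 * M; have K0 : 0 <= K by rewrite addr_ge0 ?mulr_ge0.
pose E := expR ((6 * L + 1) * (T - t0)).
(* [L + 1] instead of [L] covers the case [L = 0] *)
exists (14 * (L + 1))^-1, (3 * (K * E)); split.
- by rewrite invr_gt0.
- by rewrite !mulr_ge0 ?expR_ge0.
move=> N N0 h hh0 x0 x0c n nN.
have Nh : N%:R * h = T - t0 by rewrite /h mulrC divfK // pnatr_eq0 -lt0n.
have h0 : 0 <= h by rewrite divr_ge0 // subr_ge0 ltW.
have meshT : mesh t0 h n <= T.
  by rewrite /mesh -lerBrDl -Nh ler_wpM2r // ler_nat.
have tn_in : mesh t0 h n \in `[t0, T] by rewrite in_itv /= meshT lerDl mulr_ge0.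
have Lh : 14 * L * h <= 1.
  rewrite (le_trans (y := 14 * (L + 1) * h)) //.
    by rewrite ler_wpM2r // ler_wpM2l // lerDl.
  by rewrite mulrC -ler_pdivlMr // mul1r.
have h3 : 0 <= h ^+ 3 by rewrite exprn_ge0.
rewrite (nordsieck_vectorE h tT t0in (g := g)) // in x0c; last first.
  by move=> i i2; apply: Dg; apply: leq_trans i2 _.
have e0 : error_le (K * h ^+ 3) (x0 - nordsieck_col h (g^~ t0)).
  apply: error_leW (error_le_norm _); rewrite /K.
  by have := mulr_ge0 M0 h3; move: x0c; lra.
have MK : 2 * M * h ^+ 3 <= K * h ^+ 3.
  by rewrite ler_wpM2r // lerDr mulr_ge0.
have := nordsieck_error fL (fun t _ => gf t) Dg gM LL M0 h0 Lh MK e0 meshT.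
move=> /error_le_fst; rewrite !mxE /= => /le_trans; apply.
rewrite -[leRHS]mulrA ler_wpM2l // [leRHS]mulrAC ler_wpM2l ?(mulr_ge0 K0 h3) //.
rewrite /E -Nh. apply: growth_bound => //; by rewrite addr_ge0 // mulr_ge0.
Qed.

End Convergence.

Theorem theorem1 (R : realType) :
  exists l : 'cV[R]_3,
    (forall (f : R -> R -> R) (sigma t0 h : R) (m0 : 'cV[R]_3) (C0 : 'M[R]_3),
       0 < h -> 0 < sigma ^+ 2 -> steady_state sigma h C0 ->
       let m := fun n : nat => (ode_filter f sigma t0 h m0 C0 n).1 in
       forall n : nat, (1 <= n)%N ->
         m n = nordsieck_step l h (eval_pred f (mesh t0 h n) (m n.-1)) (m n.-1)) /\
    (forall t0 T : R, t0 < T -> order_three l t0 T).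
Proof.
exists nordsieck_weights; split; last exact: nordsieck_order_three.
move=> f sigma t0 h m0 C0 h0 sg0 CS m [//|n] _.
apply: ode_filter_nordsieck CS; first by rewrite gt_eqF.
by apply: contraTneq sg0 => ->; rewrite expr0n ltxx.
Qed.
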